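(* Assume that the cost-to-go is a linear combination of features, i.e. $\bar c_k(\mathbf{x}_k)=-\mathbf{w}_k^T\mathbf{h}(\mathbf{x}_k)$, where $\mathbf{h}(\mathbf{x}_k)=[h_1(\mathbf{x}_k),\dots,h_F(\mathbf{x}_k)]^T$ with known functions $h_i:\mathcal{X}\to\mathbb{R}$, and $\mathbf{w}_k=[w_{k,1},\dots,w_{k,F}]^T$ is a vector of weights. Let the observed data pairs be $\{(\hat{\mathbf{x}}_{k-1},\hat{\mathbf{u}}_k)\}_{1:M}$, with $\hat{\mathbf{x}}_k\sim p^{(x)}_{k\mid k-1}$ and $\hat{\mathbf{u}}_k\sim {p^{(u)}_{k\mid k-1}}^\star$, where ${p^{(u)}_{k\mid k-1}}^\star$ is the optimal policy of the forward control problem recalled in the context. Then the maximum likelihood estimate for $\mathbf{w}=[\mathbf{w}_1^T,\dots,\mathbf{w}_M^T]^T\in\mathbb{R}^{MF}$, with likelihood function $$L(\mathbf{w}):=\prod_{k=1}^M\frac{\bar q_k(\hat{\mathbf{x}}_{k-1},\hat{\mathbf{u}}_k)\exp\left(\sum_{\mathbf{x}_k}p_k(\mathbf{x}_k\mid\hat{\mathbf{x}}_{k-1},\hat{\mathbf{u}}_k)\,\mathbf{w}_k^T\mathbf{h}(\mathbf{x}_k)\right)}{\sum_{\mathbf{u}_k}\bar q_k(\hat{\mathbf{x}}_{k-1},\mathbf{u}_k)\exp\left(\sum_{\mathbf{x}_k}p_k(\mathbf{x}_k\mid\hat{\mathbf{x}}_{k-1},\mathbf{u}_k)\,\mathbf{w}_k^T\mathbf{h}(\mathbf{x}_k)\right)},$$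 is obtained by solving the convex problem $$\mathbf{w}^\star:=[\mathbf{w}_1^{\star T},\dots,\mathbf{w}_M^{\star T}]^T\in\underset{\mathbf{w}}{\arg\min}\left\{\sum_{k=1}^M\left(-\mathbb{E}_{p_k(\mathbf{x}_k\mid\hat{\mathbf{x}}_{k-1},\hat{\mathbf{u}}_k)}\left[\mathbf{w}_k^T\mathbf{h}(\mathbf{x}_k)\right]+\ln\left(\sum_{\mathbf{u}_k}\bar q_k(\hat{\mathbf{x}}_{k-1},\mathbf{u}_k)\exp\left(\mathbb{E}_{p_k(\mathbf{x}_k\mid\hat{\mathbf{x}}_{k-1},\mathbf{u}_k)}\left[\mathbf{w}_k^T\mathbf{h}(\mathbf{x}_k)\right]\right)\right)\right)\right\}.$$
   Context: All variables are discrete; a probability function (pf) is here a probability mass function, and all sums involving pfs are assumed to exist. $\mathcal{X}\subseteq\mathbb{Z}^n$ is the state space and $\mathcal{U}\subseteq\mathbb{Z}^p$ the input space. The (Markov, possibly non-stationary) system dynamics is the conditional pf $p^{(x)}_{k\mid k-1}:=p^{(x)}_k(\mathbf{x}_k\mid\mathbf{u}_k,\mathbf{x}_{k-1})$. Reference conditional pfs are given: $q^{(x)}_{k\mid k-1}:=q^{(x)}_k(\mathbf{x}_k\mid\mathbf{u}_k,\mathbf{x}_{k-1})$ and $q^{(u)}_{k\mid k-1}:=q^{(u)}_k(\mathbf{u}_k\mid\mathbf{x}_{k-1})$. $D_{KL}(p\,\|\,q)=\sum_{\mathbf{v}}p(\mathbf{v})\ln(p(\mathbf{v})/q(\mathbf{v}))$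 is the Kullback-Leibler divergence. Notation: $p_k(\mathbf{x}_k\mid\mathbf{x},\mathbf{u})$ is $p^{(x)}_k(\mathbf{x}_k\mid\mathbf{u}_k=\mathbf{u},\mathbf{x}_{k-1}=\mathbf{x})$, and $$\bar q_k(\mathbf{x}_{k-1},\mathbf{u}_k):=q^{(u)}_k(\mathbf{u}_k\mid\mathbf{x}_{k-1})\exp\left(-D_{KL}\left(p^{(x)}_k(\cdot\mid\mathbf{u}_k,\mathbf{x}_{k-1})\,\|\,q^{(x)}_k(\cdot\mid\mathbf{u}_k,\mathbf{x}_{k-1})\right)\right).$$ Forward control problem and its optimal policy. Given state costs $c_k:\mathcal{X}\to\mathbb{R}$ and priors $p_0,q_0$, the forward problem minimizes, over randomized policies $p^{(u)}_{k\mid k-1}=p^{(u)}_k(\mathbf{u}_k\mid\mathbf{x}_{k-1})$, $k=1,\dots,N$, the functional $D_{KL}(p_{0:N}\|q_{0:N})+\sum_{k=1}^N\mathbb{E}[c_k(\mathbf{X}_k)]$, where the latter expectations are under $p_{0:N}=p_0(\mathbf{x}_0)\prod_{k=1}^N p^{(x)}_{k\mid k-1}p^{(u)}_{k\mid k-1}$ and $q_{0:N}=q_0(\mathbf{x}_0)\prod_{k=1}^N q^{(x)}_{k\mid k-1}q^{(u)}_{k\mid k-1}$; it is assumed that some feasible policy sequence has finite cost. Its optimal policy is $${p^{(u)}_{k\mid k-1}}^\star=\frac{\bar q_k(\mathbf{x}_{k-1},\mathbf{u}_k)\exp\left(-\mathbb{E}_{p^{(x)}_{k\mid k-1}}[\bar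 c_k(\mathbf{X}_k)]\right)}{\sum_{\mathbf{u}_k}\bar q_k(\mathbf{x}_{k-1},\mathbf{u}_k)\exp\left(-\mathbb{E}_{p^{(x)}_{k\mid k-1}}[\bar c_k(\mathbf{X}_k)]\right)},$$ where $\bar c_k$ is the cost-to-go: $\bar c_k=c_k-\hat c_k$, $\hat c_N=0$ and $\hat c_k(\mathbf{x}_k)=\ln\left(\mathbb{E}_{q^{(u)}_{k+1\mid k}}\left[\exp\left(-D_{KL}(p^{(x)}_{k+1\mid k}\|q^{(x)}_{k+1\mid k})-\mathbb{E}_{p^{(x)}_{k+1\mid k}}[\bar c_{k+1}(\mathbf{X}_{k+1})]\right)\right]\right)$ for $k<N$. The number $M$ of observed data pairs may differ from the horizon $N$ (e.g. when data come from multiple experiments). The maximum likelihood estimate is a maximizer of $L$ over $\mathbf{w}\in\mathbb{R}^{MF}$. *)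

(* Defs.v *)
(* MathComp-Analysis. *)
From HB Require Import structures.
From mathcomp Require Import all_boot all_order all_algebra.
From mathcomp Require Import all_classical all_reals all_analysis.

Set Implicit Arguments.
Unset Strict Implicit.
Unset Printing Implicit Defensive.

Import Order.TTheory GRing.Theory Num.Theory.
Local Open Scope classical_set_scope.
Local Open Scope ring_scope.

Section Sums.
Context {R : realType} {T : choiceType}.

(* [\esum] is only meant for nonnegative terms, so a signed sum over a
   (possibly infinite) discrete set is split into its two parts. *)
Definition signed_esum (D : set T) (f : T -> \bar R) : \bar R :=
  (\esum_(x in D) (f^\+ x) - \esum_(x in D) (f^\- x))%E.

(* Real value of the sum; only meaningful when [has_sum D f]. *)
Definition dsum (D : set T) (f : T -> R) : R :=
  fine (signed_esum D (EFin \o f)).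

Definition has_sum (D : set T) (f : T -> R) : Prop := summable D (EFin \o f).

Definition is_pf (D : set T) (P : T -> R) : Prop :=
  (forall x, D x -> 0 <= P x) /\ (\esum_(x in D) (P x)%:E = 1)%E.

Definition expectation (D : set T) (P f : T -> R) : R :=
  dsum D (fun x => P x * f x).

Definition has_expectation (D : set T) (P f : T -> R) : Prop :=
  has_sum D (fun x => P x * f x).

(* Conventions: 0 ln(0 / b) = 0, and a ln(a / 0) = +oo for a > 0. *)
Definition kl_term (a b : R) : \bar R :=
  if a == 0 then 0%E else if b == 0 then +oo%E else (a * ln (a / b))%:E.

(* Extended-real valued: +oo is a legitimate value of the divergence. *)
Definition KL (D : set T) (P Q : T -> R) : \bar R :=
  signed_esum D (fun x => kl_term (P x) (Q x)).

End Sums.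

Definition argmin {R : realType} {T : Type} (f : T -> R) : set T :=
  [set w | forall v, f w <= f v].

Definition argmax {R : realType} {T : Type} (f : T -> R) : set T :=
  [set w | forall v, f v <= f w].

(* Functions are total on Z^n and Z^p; only their values on [states] and
   [inputs] matter. The time index is a [nat], ranging over 1, ..., N:
   [plant k x u y]     is p^(x)_k (x_k = y | u_k = u, x_{k-1} = x),
   [ref_plant k x u y] is q^(x)_k (x_k = y | u_k = u, x_{k-1} = x),
   [ref_policy k x u]  is q^(u)_k (u_k = u | x_{k-1} = x). *)
Record model (R : realType) (n p : nat) := Model {
  states : set 'rV[int]_n;
  inputs : set 'rV[int]_p;
  plant : nat -> 'rV[int]_n -> 'rV[int]_p -> 'rV[int]_n -> R;
  ref_plant : nat -> 'rV[int]_n -> 'rV[int]_p -> 'rV[int]_n -> R;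
  ref_policy : nat -> 'rV[int]_n -> 'rV[int]_p -> R
}.

Section Control.
Context {R : realType} {n p : nat}.
Variables (m : model R n p) (N : nat).
Local Notation X := (states m).
Local Notation U := (inputs m).

Definition is_policy (pi : nat -> 'rV[int]_n -> 'rV[int]_p -> R) : Prop :=
  forall k x, (0 < k <= N)%N -> X x -> is_pf U (pi k x).

Definition is_kernel
    (P : nat -> 'rV[int]_n -> 'rV[int]_p -> 'rV[int]_n -> R) : Prop :=
  forall k x u, (0 < k <= N)%N -> X x -> U u -> is_pf X (P k x u).

Definition model_pfs : Prop :=
  [/\ is_kernel (plant m), is_kernel (ref_plant m) & is_policy (ref_policy m)].

Definition step_KL (k : nat) (x : 'rV[int]_n) (u : 'rV[int]_p) : \bar R :=
  KL X (plant m k x u) (ref_plant m k x u).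

(* [fine] is harmless: the divergence of pfs is never -oo, and
   [expeR (-oo) = 0]. *)
Definition qbar (k : nat) (x : 'rV[int]_n) (u : 'rV[int]_p) : R :=
  ref_policy m k x u * fine (expeR (- step_KL k x u)).

(* A trajectory is (x_0, ..., x_N) together with (u_1, ..., u_N); the
   component of index [i] of the second one is u_{i+1}. *)
Definition trajectory : choiceType :=
  ({ffun 'I_N.+1 -> 'rV[int]_n} * {ffun 'I_N -> 'rV[int]_p})%type.

Definition trajectories : set trajectory :=
  [set t : trajectory | (forall i, X (t.1 i)) /\ (forall i, U (t.2 i))].

Definition joint (init : 'rV[int]_n -> R)
    (P : nat -> 'rV[int]_n -> 'rV[int]_p -> 'rV[int]_n -> R)
    (pi : nat -> 'rV[int]_n -> 'rV[int]_p -> R) (t : trajectory) : R :=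
  init (t.1 ord0) *
  \prod_(i < N) (P i.+1 (t.1 (inord i)) (t.2 i) (t.1 (inord i.+1)) *
                 pi i.+1 (t.1 (inord i)) (t.2 i)).

Section Forward.
Variables (p0 q0 : 'rV[int]_n -> R) (c : nat -> 'rV[int]_n -> R).

Definition forward_cost (pi : nat -> 'rV[int]_n -> 'rV[int]_p -> R) : \bar R :=
  (KL trajectories (joint p0 (plant m) pi)
                   (joint q0 (ref_plant m) (ref_policy m)) +
   \sum_(i < N) (expectation trajectories (joint p0 (plant m) pi)
                   (fun t => c i.+1 (t.1 (inord i.+1))))%:E)%E.

(* Policies for which the expected state costs exist. *)
Definition feasible (pi : nat -> 'rV[int]_n -> 'rV[int]_p -> R) : Prop :=
  is_policy pi /\
  forall i : 'I_N, has_expectation trajectories (joint p0 (plant m) pi)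
                     (fun t => c i.+1 (t.1 (inord i.+1))).

Definition forward_optimal (pi : nat -> 'rV[int]_n -> 'rV[int]_p -> R) : Prop :=
  feasible pi /\
  forall pi', feasible pi' -> (forward_cost pi <= forward_cost pi')%E.

(* \hat c_k, computed from \bar c_{k+1}. With [lne], a vanishing (infinite)
   expectation gives -oo (+oo), so that [is_cost_to_go] below excludes it. *)
Definition chat (cbar : nat -> 'rV[int]_n -> R) (k : nat) (x : 'rV[int]_n)
    : \bar R :=
  if k == N then 0%E else
  lne (\esum_(u in U) ((ref_policy m k.+1 x u)%:E *
    expeR (- step_KL k.+1 x u
           - (expectation X (plant m k.+1 x u) (cbar k.+1))%:E)))%E.

Definition is_cost_to_go (cbar : nat -> 'rV[int]_n -> R) : Prop :=
  forall k x, (0 < k <= N)%N -> X x ->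
    ((cbar k x)%:E = (c k x)%:E - chat cbar k x)%E.

End Forward.

(* Unnormalized and normalized closed form of the optimal policy at time [k],
   for the cost-to-go [V] at time [k]. *)
Definition policy_weight (k : nat) (V : 'rV[int]_n -> R)
    (x : 'rV[int]_n) (u : 'rV[int]_p) : R :=
  qbar k x u * expR (- expectation X (plant m k x u) V).

Definition closed_form_policy (k : nat) (V : 'rV[int]_n -> R)
    (x : 'rV[int]_n) (u : 'rV[int]_p) : R :=
  policy_weight k V x u / dsum U (policy_weight k V x).

(* Existence of the sums defining the cost-to-go and the optimal policy. *)
Definition control_sums_exist (cbar : nat -> 'rV[int]_n -> R) : Prop :=
  forall k x, (0 < k <= N)%N -> X x ->
    (forall u, U u -> has_expectation X (plant m k x u) (cbar k)) /\
    has_sum U (policy_weight k (cbar k) x).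

End Control.

Section Estimation.
Context {R : realType} {n p : nat}.
Variables (m : model R n p) (F M : nat) (h : 'I_F -> 'rV[int]_n -> R).
Local Notation X := (states m).
Local Notation U := (inputs m).

Definition features (v : 'rV[R]_F) (x : 'rV[int]_n) : R :=
  \sum_(i < F) v 0 i * h i x.

(* The block w_k of w = [w_1^T, ..., w_M^T]^T ([mxvec] is row-major). *)
Definition block (w : 'rV[R]_(M * F)) (k : 'I_M) : 'rV[R]_F :=
  row k (vec_mx w).

(* Sample [k] is the pair (xprev k, uhat k), i.e. (\hat x_{k-1}, \hat u_k),
   collected at time [stage k] of an experiment. For a single experiment
   [stage k] is k (the ordinal [k : 'I_M] being shifted by one); a general
   [stage] accounts for data from several experiments, hence for M > N. *)
Variables (stage : 'I_M -> nat)
          (xprev : 'I_M -> 'rV[int]_n) (uhat : 'I_M -> 'rV[int]_p).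

Definition tilted_weight (k : 'I_M) (v : 'rV[R]_F) (u : 'rV[int]_p) : R :=
  qbar m (stage k) (xprev k) u *
  expR (expectation X (plant m (stage k) (xprev k) u) (features v)).

Definition likelihood (w : 'rV[R]_(M * F)) : R :=
  \prod_(k < M) (tilted_weight k (block w k) (uhat k) /
                 dsum U (tilted_weight k (block w k))).

Definition objective (w : 'rV[R]_(M * F)) : R :=
  \sum_(k < M)
    (- expectation X (plant m (stage k) (xprev k) (uhat k))
                     (features (block w k))
     + ln (dsum U (tilted_weight k (block w k)))).

(* Existence of the sums in [likelihood] and [objective], for all weights. *)
Definition estimation_sums_exist : Prop :=
  forall k : 'I_M,
    (forall u i, U u ->
       has_expectation X (plant m (stage k) (xprev k) u) (h i)) /\
    (forall v, has_sum U (tilted_weight k v)).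

End Estimation.

(* Main.v *)
Require Import Defs.
From HB Require Import structures.
From mathcomp Require Import all_boot all_order all_algebra.
From mathcomp Require Import all_classical all_reals all_analysis.
From mathcomp Require Import ring.

Set Implicit Arguments.
Unset Strict Implicit.
Unset Printing Implicit Defensive.

Import Order.TTheory GRing.Theory Num.Theory.
Local Open Scope classical_set_scope.
Local Open Scope ring_scope.

(** Up to a positive factor that does not depend on the weights, the likelihood
    is the exponential of minus the objective: each factor of the likelihood is

      qbar_k * exp (E_k[w_k^T h]) / Z_k (w_k)
        = qbar_k * exp (- (- E_k[w_k^T h] + ln (Z_k (w_k)))),

    where Z_k is the normalizer of the policy. As exp is increasing, the
    maximizers of the one are the minimizers of the other ([likelihoodE],
    [argmax_expRN]). What makes this legitimate is that qbar_k and Z_k are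
    positive: an observed input has positive probability under the optimal
    policy, whose numerator is then nonzero, so the positive term of that input
    bounds Z_k from below ([normalizer_gt0]).

    For convexity, the expectation of the features is linear in the weights, so
    each summand of the objective is a linear function plus a log-sum-exp
    function of affine arguments. The input space may be infinite, and
    [log_sum_exp_convex] is the corresponding form of Hoelder's inequality; it
    follows from the convexity of the exponential applied termwise, after both
    families have been normalized to total mass 1.

    The first part of the file gives the needed calculus of [dsum], linearity
    and monotonicity, on absolutely summable families. *)

(* The name is also that of the expectation of a random variable. *)
Local Notation expectation := Defs.expectation.

(** * Linearity and monotonicity of discrete sums *)

Section DiscreteSums.
Context {R : realType} {T : choiceType}.
Implicit Types (D : set T) (f g : T -> R) (c : R).

(** The converse inequality, hence [esumZl], is the same statement for the
    factor 1 / c. *)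
Lemma le_esumZl D c f : 0 < c ->
  (\esum_(x in D) (c * f x)%:E <= c%:E * \esum_(x in D) (f x)%:E)%E.
Proof.
move=> c0; apply: ge_ereal_sup => _ [A [finA AD] <-].
rewrite fsbig_finite//= sumEFin -mulr_sumr EFinM lee_pmul2l// ?lte_fin//.
apply: ereal_sup_ubound; exists A => //.
by rewrite fsbig_finite//= sumEFin.
Qed.

Lemma esumZl D c f : 0 <= c ->
  \esum_(x in D) (c * f x)%:E = (c%:E * \esum_(x in D) (f x)%:E)%E.
Proof.
rewrite le_eqVlt => /predU1P[<-|c0].
  by rewrite mul0e esum1// => x _; rewrite mul0r.
apply/eqP; rewrite eq_le le_esumZl//=.
rewrite muleC -lee_pdivlMr// [leRHS]muleC.
have {1}-> : f = fun x => c^-1 * (c * f x).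
  by apply/funext => x; rewrite mulKf// gt_eqF.
by rewrite le_esumZl// invr_gt0.
Qed.

Lemma has_sumE D f : has_sum D f = (\esum_(x in D) `|f x|%:E < +oo)%E :> Prop.
Proof. by []. Qed.

Lemma le_has_sum D f g :
  (forall x, D x -> `|f x| <= g x) -> has_sum D g -> has_sum D f.
Proof.
move=> fg; rewrite !has_sumE; apply: le_lt_trans; apply: le_esum => x Dx.
by rewrite lee_fin (le_trans (fg x Dx)) ?ler_norm.
Qed.

Lemma has_sum0 D : has_sum D (fun=> 0 : R).
Proof. by rewrite has_sumE esum1 ?ltry// => x _; rewrite normr0. Qed.

Lemma has_sumD D f g : has_sum D f -> has_sum D g ->
  has_sum D (fun x => f x + g x).
Proof. exact: summableD. Qed.

Lemma has_sumZ D c f : has_sum D f -> has_sum D (fun x => c * f x).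
Proof.
rewrite !has_sumE => fD.
rewrite (eq_esum (b := fun x => (`|c| * `|f x|)%:E)); last first.
  by move=> x _; rewrite normrM.
have fin : \esum_(x in D) `|f x|%:E \is a fin_num.
  by rewrite ge0_fin_numE// esum_ge0// => x _; rewrite lee_fin.
by rewrite esumZl// -(fineK fin) -EFinM ltry.
Qed.

Lemma has_sum_sum (I : Type) (r : seq I) (D : set T) (f : I -> T -> R) :
  (forall i, has_sum D (f i)) -> has_sum D (fun x => \sum_(i <- r) f i x).
Proof.
move=> fD; elim: r => [|i r IH].
  by under [fun x => _]funext do rewrite big_nil; exact: has_sum0.
by under [fun x => _]funext do rewrite big_cons; exact: has_sumD.
Qed.

Lemma eq_dsum D f g : (forall x, D x -> f x = g x) -> dsum D f = dsum D g.
Proof.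
move=> fg; rewrite /dsum /signed_esum; congr (fine (_ - _)).
  by apply: eq_esum => x Dx; rewrite !funeposE /= fg.
by apply: eq_esum => x Dx; rewrite !funenegE /= fg.
Qed.

Lemma dsum_ge0E D f : (forall x, D x -> 0 <= f x) ->
  dsum D f = fine (\esum_(x in D) (f x)%:E).
Proof.
move=> f0; rewrite /dsum /signed_esum.
rewrite (eq_esum (b := fun x => (f x)%:E)); last first.
  by move=> x Dx; rewrite funeposE /= max_l// lee_fin f0.
rewrite [X in (_ - X)%E]esum1 ?sube0// => x Dx.
by rewrite funenegE /= max_r// lee_fin oppr_le0 f0.
Qed.

(** Nonnegative summable families are where [dsum] and [esum] can be exchanged
    freely; the general case is reduced to it by [dsum_normB]. *)
Lemma has_sum_fin D f : (forall x, D x -> 0 <= f x) -> has_sum D f ->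
  \esum_(x in D) (f x)%:E = (dsum D f)%:E.
Proof.
move=> f0; rewrite has_sumE (eq_esum (b := fun x => (f x)%:E)); last first.
  by move=> x Dx; rewrite ger0_norm// f0.
by move=> ?; rewrite dsum_ge0E// fineK// ge0_fin_numE// esum_ge0.
Qed.

Lemma le_dsum D f g : (forall x, D x -> 0 <= f x <= g x) -> has_sum D g ->
  dsum D f <= dsum D g.
Proof.
move=> fg gD.
have f0 x : D x -> 0 <= f x by move=> /fg/andP[].
have g0 x : D x -> 0 <= g x by move=> /fg/andP[]; exact: le_trans.
have fD : has_sum D f.
  apply: le_has_sum gD => x Dx.
  by rewrite ger0_norm ?f0//; case/andP: (fg x Dx).
rewrite -lee_fin -!has_sum_fin//.
by apply: le_esum => x Dx; rewrite lee_fin; case/andP: (fg x Dx).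
Qed.

Lemma dsum_ge_term D f x : (forall y, D y -> 0 <= f y) -> has_sum D f -> D x ->
  f x <= dsum D f.
Proof.
move=> f0 fD Dx; rewrite -lee_fin -has_sum_fin//.
apply: esum_ge; exists [set x]; last by rewrite fsbig_set1.
by split=> // _ ->.
Qed.

(** An infinite difference of the two parts, of either sign, is sent to 0 by
    [fine], so the identity extends to divergent sums. *)
Lemma dsumN D f : dsum D (fun x => - f x) = - dsum D f.
Proof.
rewrite /dsum /signed_esum.
have -> : EFin \o (fun x => - f x) = (\- (EFin \o f))%E by [].
rewrite funeposN funenegN.
by case: (esum D _) => [r| |]; case: (esum D _) => [s| |] //=;
  rewrite ?oppr0 ?opprB.
Qed.

Lemma dsumB_ge0 D f g : (forall x, D x -> 0 <= f x) ->
  (forall x, D x -> 0 <= g x) -> has_sum D f -> has_sum D g ->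
  dsum D (fun x => f x - g x) = dsum D f - dsum D g.
Proof.
move=> f0 g0 fD gD; rewrite {1}/dsum /signed_esum.
rewrite (_ : EFin \o _ = ((EFin \o f) \- (EFin \o g))%E)//.
by rewrite esumB// ?has_sum_fin.
Qed.

Lemma dsumD_ge0 D f g : (forall x, D x -> 0 <= f x) ->
  (forall x, D x -> 0 <= g x) -> has_sum D f -> has_sum D g ->
  dsum D (fun x => f x + g x) = dsum D f + dsum D g.
Proof.
move=> f0 g0 fD gD; apply: EFin_inj.
rewrite -has_sum_fin; last 2 first.
- by move=> x Dx; rewrite addr_ge0 ?f0 ?g0.
- exact: has_sumD.
by rewrite EFinD -!has_sum_fin// -esumD.
Qed.

(** Twice the negative part. Writing a family as its absolute value minus this
    excess presents it as a difference of nonnegative families that are built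
    from ring operations, unlike positive and negative parts. *)
Let excess f x := `|f x| - f x.

Let excess_ge0 f x : 0 <= excess f x.
Proof. by rewrite subr_ge0 ler_norm. Qed.

Lemma has_sum_norm D f : has_sum D f -> has_sum D (fun x => `|f x|).
Proof.
rewrite !has_sumE => fD.
rewrite (eq_esum (b := fun x => `|f x|%:E))//.
by move=> x _; rewrite normr_id.
Qed.

Lemma has_sumN D f : has_sum D f -> has_sum D (fun x => - f x).
Proof.
rewrite !has_sumE => fD.
rewrite (eq_esum (b := fun x => `|f x|%:E))//.
by move=> x _; rewrite normrN.
Qed.

Let has_sum_excess D f : has_sum D f -> has_sum D (excess f).
Proof.
by move=> fD; apply: has_sumD; [exact: has_sum_norm|exact: has_sumN].
Qed.

(** Linearity on signed families follows from this and from additivity and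
    homogeneity on nonnegative ones. *)
Lemma dsum_normB D f : has_sum D f ->
  dsum D f = dsum D (fun x => `|f x|) - dsum D (excess f).
Proof.
move=> fD; rewrite -dsumB_ge0//; [|exact: has_sum_norm|exact: has_sum_excess].
by congr dsum; apply/funext => x; rewrite /excess subKr.
Qed.

Lemma dsumD D f g : has_sum D f -> has_sum D g ->
  dsum D (fun x => f x + g x) = dsum D f + dsum D g.
Proof.
move=> fD gD; rewrite (dsum_normB fD) (dsum_normB gD) addrACA -opprD.
have nfD := has_sum_norm fD; have ngD := has_sum_norm gD.
have efD := has_sum_excess fD; have egD := has_sum_excess gD.
rewrite -!dsumD_ge0// -dsumB_ge0//; try exact: has_sumD.
- by congr dsum; apply/funext => x; rewrite /excess; ring.
- by move=> x _; rewrite addr_ge0.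
Qed.

Lemma dsumZ_ge0 D c f : 0 <= c -> (forall x, D x -> 0 <= f x) ->
  has_sum D f -> dsum D (fun x => c * f x) = c * dsum D f.
Proof.
move=> c0 f0 fD; apply: EFin_inj.
rewrite -has_sum_fin; [|by move=> x /f0; exact: mulr_ge0|exact: has_sumZ].
by rewrite EFinM -has_sum_fin// esumZl.
Qed.

Lemma dsumZ D c f : has_sum D f -> dsum D (fun x => c * f x) = c * dsum D f.
Proof.
move=> fD; wlog c0 : c / 0 <= c.
  move=> W; have [/W//|/ltW cle0] := leP 0 c.
  rewrite -[RHS]opprK -mulNr -W ?oppr_ge0// -dsumN.
  by congr dsum; apply/funext => x; rewrite mulNr opprK.
have nfD := has_sum_norm fD; have efD := has_sum_excess fD.
rewrite (dsum_normB fD) mulrBr -!dsumZ_ge0// -dsumB_ge0//; try exact: has_sumZ.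
- by congr dsum; apply/funext => x; rewrite /excess; ring.
- by move=> x _; rewrite mulr_ge0.
- by move=> x _; rewrite mulr_ge0.
Qed.

Lemma dsum_gt0 D f x : (forall y, D y -> 0 <= f y) -> has_sum D f -> D x ->
  0 < f x -> 0 < dsum D f.
Proof. by move=> f0 fD Dx fx; apply: lt_le_trans fx _; exact: dsum_ge_term. Qed.

End DiscreteSums.

(** * Convexity of log-sum-exp *)

Section LogSumExp.
Context {R : realType} {T : choiceType}.
Variables (D : set T) (q a b : T -> R) (u0 : T) (t : {i01 R}).
Hypothesis q_ge0 : forall u, D u -> 0 <= q u.
Hypothesis q_gt0 : 0 < q u0.
Hypothesis Du0 : D u0.
Hypothesis aD : has_sum D (fun u => q u * expR (a u)).
Hypothesis bD : has_sum D (fun u => q u * expR (b u)).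

Local Notation s := (t%:num : R).

(** With A and B the two sums on the right, convexity of exp at the points
    a u - ln A and b u - ln B bounds each term on the left by
    A^t B^(1-t) (t q e^a / A + (1-t) q e^b / B); the two quotients sum to 1, so
    that the whole sum is at most A^t B^(1-t). *)
Lemma log_sum_exp_convex :
  ln (dsum D (fun u => q u * expR (s * a u + (1 - s) * b u))) <=
  s * ln (dsum D (fun u => q u * expR (a u))) +
  (1 - s) * ln (dsum D (fun u => q u * expR (b u))).
Proof.
set A := dsum D (fun u => q u * expR (a u)).
set B := dsum D (fun u => q u * expR (b u)).
have term_ge0 c u : D u -> 0 <= q u * expR c.
  by move=> /q_ge0 qu; rewrite mulr_ge0 ?expR_ge0.
have term_gt0 c : 0 < q u0 * expR c by rewrite mulr_gt0 ?expR_gt0.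
have A0 : 0 < A by apply: (@dsum_gt0 _ _ _ _ u0) => // u; exact: term_ge0.
have B0 : 0 < B by apply: (@dsum_gt0 _ _ _ _ u0) => // u; exact: term_ge0.
set C := s * ln A + (1 - s) * ln B.
pose maj u := expR C * (s / A * (q u * expR (a u)) +
                        (1 - s) / B * (q u * expR (b u))).
have le_maj u : D u -> q u * expR (s * a u + (1 - s) * b u) <= maj u.
  move=> /q_ge0 qu.
  have := convex_expR t (a u - ln A) (b u - ln B).
  rewrite !convRE /= /unstable.onem !expRB !lnK// => conv.
  rewrite (_ : s * a u + _ =
    C + (s * (a u - ln A) + (1 - s) * (b u - ln B))); last by rewrite /C; ring.
  rewrite expRD mulrCA ler_pM2l ?expR_gt0//.
  apply: le_trans (ler_wpM2l qu conv) _.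
  by rewrite le_eqVlt; apply/orP; left; apply/eqP; ring.
have sumAB : has_sum D (fun u => s / A * (q u * expR (a u)) +
    (1 - s) / B * (q u * expR (b u))).
  by apply: has_sumD; exact: has_sumZ.
have maj_sum : has_sum D maj by exact: has_sumZ.
have dsum_maj : dsum D maj = expR C.
  rewrite dsumZ// dsumD ?dsumZ//; try exact: has_sumZ.
  by rewrite -/A -/B !divfK ?gt_eqF// addrC subrK mulr1.
rewrite -[C]expRK -dsum_maj ler_ln ?posrE; last 2 first.
- apply: (@dsum_gt0 _ _ _ _ u0) => // [u|]; first exact: term_ge0.
  by apply: le_has_sum maj_sum => u Du; rewrite ger0_norm ?term_ge0 ?le_maj.
- by rewrite dsum_maj expR_gt0.
apply: le_dsum maj_sum => u Du; apply/andP; split; first exact: term_ge0.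
exact: le_maj.
Qed.

End LogSumExp.

(** * Linearity in the weights *)

Section Features.
Context {R : realType} {n F : nat}.
Variables (X : set 'rV[int]_n) (P : 'rV[int]_n -> R).
Variable h : 'I_F -> 'rV[int]_n -> R.

Lemma featuresD (v w : 'rV[R]_F) x :
  features h (v + w) x = features h v x + features h w x.
Proof.
by rewrite -big_split; apply: eq_bigr => i _ /=; rewrite !mxE mulrDl.
Qed.

Lemma featuresZ (c : R) (v : 'rV[R]_F) x :
  features h (c *: v) x = c * features h v x.
Proof. by rewrite mulr_sumr; apply: eq_bigr => i _ /=; rewrite !mxE mulrA. Qed.

Hypothesis hP : forall i, has_expectation X P (h i).

Lemma has_expectation_features v : has_expectation X P (features h v).
Proof.
rewrite /has_expectation (_ : (fun x => _) =
    fun x => \sum_(i < F) v 0 i * (P x * h i x)).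
  by apply: has_sum_sum => i; exact/has_sumZ/hP.
apply/funext => x; rewrite mulr_sumr.
by apply: eq_bigr => i _; rewrite mulrCA.
Qed.

Lemma expectation_features_conv (s : R) (v w : 'rV[R]_F) :
  expectation X P (features h (s *: v + (1 - s) *: w)) =
  s * expectation X P (features h v) +
  (1 - s) * expectation X P (features h w).
Proof.
have hv := has_expectation_features v; have hw := has_expectation_features w.
rewrite /expectation -!dsumZ// -dsumD; try exact: has_sumZ.
congr dsum; apply/funext => x; rewrite featuresD !featuresZ; ring.
Qed.

End Features.

(** * Maximum likelihood as convex minimization *)

Lemma expectationN {R : realType} {T : choiceType} (D : set T) (P f : T -> R) :
  expectation D P (fun x => - f x) = - expectation D P f.
Proof.
by rewrite /expectation -dsumN; congr dsum; apply/funext => x; rewrite mulrN.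
Qed.

Lemma qbar_ge0 (R : realType) (n p : nat) (m : model R n p) k x u :
  0 <= ref_policy m k x u -> 0 <= qbar m k x u.
Proof. by move=> q0; rewrite mulr_ge0// fine_ge0// expeR_ge0. Qed.

(** The statistical model is the optimal policy for the cost-to-go that the
    weights parametrize. *)
Lemma tilted_weightE (R : realType) (n p : nat) (m : model R n p) (F M : nat)
  (h : 'I_F -> 'rV[int]_n -> R) (stage : 'I_M -> nat)
  (xprev : 'I_M -> 'rV[int]_n) (k : 'I_M) (v : 'rV[R]_F) :
  tilted_weight m h stage xprev k v =
  policy_weight m (stage k) (fun x => - features h v x) (xprev k).
Proof. by apply/funext => u; rewrite /policy_weight expectationN opprK. Qed.

Lemma block_conv (R : realType) (F M : nat) (s : R) (v w : 'rV[R]_(M * F)) k :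
  block (s *: v + (1 - s) *: w) k = s *: block v k + (1 - s) *: block w k.
Proof. by rewrite /block !linearD !linearZ. Qed.

Lemma argmax_expRN (R : realType) (T : Type) (c : R) (f g : T -> R) :
  0 < c -> (forall w, f w = c * expR (- g w)) -> argmax f = argmin g.
Proof.
move=> c0 fE; apply/seteqP; split=> w wopt v; have := wopt v;
  by rewrite !fE ler_pM2l// ler_expR lerN2.
Qed.

Section MaximumLikelihood.
Context {R : realType} {n p : nat}.
Variables (m : model R n p) (F M : nat) (h : 'I_F -> 'rV[int]_n -> R).
Variables (stage : 'I_M -> nat)
          (xprev : 'I_M -> 'rV[int]_n) (uhat : 'I_M -> 'rV[int]_p).
Local Notation U := (inputs m).
Local Notation weight := (tilted_weight m h stage xprev).

Hypothesis sums : estimation_sums_exist m h stage xprev.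
Hypothesis qbarU : forall k u, U u -> 0 <= qbar m (stage k) (xprev k) u.
Hypothesis uhatU : forall k, U (uhat k).
Hypothesis qbar_uhat : forall k, 0 < qbar m (stage k) (xprev k) (uhat k).

(** The term of the observed input is positive and bounds the sum below. *)
Lemma normalizer_gt0 k v : 0 < dsum U (weight k v).
Proof.
apply: (@dsum_gt0 _ _ _ _ (uhat k)) => //.
- by move=> u /qbarU q0; rewrite mulr_ge0 ?expR_ge0.
- by have [_] := sums k; exact.
- by rewrite mulr_gt0 ?expR_gt0.
Qed.

Lemma likelihoodE w : likelihood m h stage xprev uhat w =
  (\prod_(k < M) qbar m (stage k) (xprev k) (uhat k)) *
  expR (- objective m h stage xprev uhat w).
Proof.
rewrite /objective -sumrN expR_sum -big_split; apply: eq_bigr => k _ /=.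
by rewrite opprD opprK expRD expRN lnK ?posrE ?normalizer_gt0// mulrA.
Qed.

Lemma objective_convex :
  @convex_function R 'rV[R]_(M * F) setT (objective m h stage xprev uhat).
Proof.
move=> t v w _ _; rewrite convRE /= /unstable.onem.
(* Unfolds the abstract convex combination of weight vectors. *)
change (objective m h stage xprev uhat (t%:num *: v + (1 - t%:num) *: w) <=
  t%:num * objective m h stage xprev uhat v +
  (1 - t%:num) * objective m h stage xprev uhat w).
rewrite /objective !mulr_sumr -big_split; apply: ler_sum => k _ /=.
have [hE hW] := sums k.
rewrite block_conv expectation_features_conv; last by move=> i; exact: hE.
(* The linear parts agree; only the log-sum-exp parts differ. *)
set e1 := expectation _ _ _; set e2 := expectation _ _ _.
rewrite !mulrDr [leRHS]addrACA !mulrN -opprD lerD2l.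
have -> : dsum U (weight k (t%:num *: block v k + (1 - t%:num) *: block w k)) =
  dsum U (fun u => qbar m (stage k) (xprev k) u *
    expR (t%:num * expectation (states m) (plant m (stage k) (xprev k) u)
                     (features h (block v k)) +
    (1 - t%:num) * expectation (states m) (plant m (stage k) (xprev k) u)
                     (features h (block w k)))).
  apply: eq_dsum => u Uu; rewrite /tilted_weight expectation_features_conv//.
  by move=> i; exact: hE.
exact: (log_sum_exp_convex _ (qbarU k) (qbar_uhat k) (uhatU k) (hW _) (hW _)).
Qed.

End MaximumLikelihood.

Theorem theorem2 (R : realType) (n p : nat) (m : model R n p)
  (N : nat) (p0 q0 : 'rV[int]_n -> R) (c : nat -> 'rV[int]_n -> R)
  (Hmodel : model_pfs m N)
  (Hp0 : is_pf (states m) p0) (Hq0 : is_pf (states m) q0)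
  (Hfinite : exists pi, feasible m N p0 c pi /\
                        (forward_cost m N p0 q0 c pi < +oo)%E)
  (cbar : nat -> 'rV[int]_n -> R)
  (Hcbar : is_cost_to_go m N c cbar)
  (Hcontrol : control_sums_exist m N cbar)
  (pstar : nat -> 'rV[int]_n -> 'rV[int]_p -> R)
  (Hopt : forward_optimal m N p0 q0 c pstar)
  (Hpstar : forall k x u, (0 < k <= N)%N -> states m x -> inputs m u ->
     pstar k x u = closed_form_policy m k (cbar k) x u)
  (F : nat) (h : 'I_F -> 'rV[int]_n -> R)
  (wtrue : nat -> 'rV[R]_F)
  (Hlinear : forall k x, (0 < k <= N)%N -> states m x ->
     cbar k x = - features h (wtrue k) x)
  (M : nat) (stage : 'I_M -> nat)
  (xprev : 'I_M -> 'rV[int]_n) (uhat : 'I_M -> 'rV[int]_p)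
  (xhat : 'I_M -> 'rV[int]_n)
  (Hstage : forall k, (0 < stage k <= N)%N)
  (Hxprev : forall k, states m (xprev k))
  (Huhat : forall k, inputs m (uhat k) /\
     0 < pstar (stage k) (xprev k) (uhat k))
  (Hxhat : forall k, states m (xhat k) /\
     0 < plant m (stage k) (xprev k) (uhat k) (xhat k))
  (Hestimation : estimation_sums_exist m h stage xprev) :
  [/\ forall w : 'rV[R]_(M * F),
        likelihood m h stage xprev uhat w =
        \prod_(k < M) closed_form_policy m (stage k)
          (fun x => - features h (block w k) x) (xprev k) (uhat k),
      @convex_function R 'rV[R]_(M * F) setT
        (objective m h stage xprev uhat)
    & argmax (likelihood m h stage xprev uhat) =
      argmin (objective m h stage xprev uhat)].
Proof.
case: Hmodel => _ _ Hpolicy.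
have qbarU k u : inputs m u -> 0 <= qbar m (stage k) (xprev k) u.
  move=> Uu; apply: qbar_ge0.
  have [pol_ge0 _] := Hpolicy (stage k) (xprev k) (Hstage k) (Hxprev k).
  exact: pol_ge0.
have uhatU k : inputs m (uhat k) by case: (Huhat k).
(* A vanishing weight would give the observed input probability 0. *)
have qbar_uhat k : 0 < qbar m (stage k) (xprev k) (uhat k).
  rewrite lt_neqAle qbarU// andbT; apply/eqP => qbar0.
  have [Uk] := Huhat k; rewrite Hpstar// /closed_form_policy /policy_weight.
  by rewrite -qbar0 !mul0r ltxx.
split.
- move=> w; apply: eq_bigr => k _.
  by rewrite /closed_form_policy tilted_weightE.
- exact: objective_convex.
- apply: argmax_expRN; last exact: likelihoodE.
  by apply: prodr_gt0 => k _.
Qed.
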